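(* Let $n\ge 2$ be an integer and let $\nu\in\{1,2,\ldots,n-1\}$. The sum $C_n(\nu)=\sum_{l=1}^{n-1}\cos\frac{2\pi\nu l}{n}\cdot\csc\frac{\pi l}{n}$ may be represented by the following integral, containing the discrete Poisson kernel: $$\sum_{l=1}^{n-1}\cos\frac{2\pi\nu l}{n}\cdot\csc\frac{\pi l}{n}=\frac{2n}{\pi}\int_0^1\frac{(1+x^n)\cos\frac{2\pi\nu}{n}-x^{n-1}-x}{1+x^n}\cdot\frac{dx}{x^2-2x\cos\frac{2\pi\nu}{n}+1}.$$ This may also be written in several alternative forms; for example, $$\sum_{l=1}^{n-1}\cos\frac{2\pi\nu l}{n}\cdot\csc\frac{\pi l}{n}=(n-2\nu)\cot\frac{2\pi\nu}{n}-\frac{n}{\pi}\int_0^\infty\frac{\cosh\left[x\left(\frac n2-1\right)\right]}{\cosh\frac{xn}{2}\,\left(\cosh x-\cos\frac{2\pi\nu}{n}\right)}\,dx.$$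
   Formalization: In the second identity, when 2ν = n the term (n−2ν)cot(2πν/n) is undefined (0 times cot π); it is read there as its limit as the variable ν tends to n/2, namely −n/π, and the existence of that limit is part of the claim. *)

(* Defs.v *)
From Stdlib Require Export Reals.
From Coquelicot Require Export Coquelicot.
Open Scope R_scope.

(* Meaningful only where sin x <> 0; Rinv is total. *)
Definition csc (x : R) : R := / sin x.

Definition cot (x : R) : R := cos x / sin x.

Definition cos_csc_sum (n nu : nat) : R :=
  sum_n_m (fun l : nat =>
             cos (2 * PI * INR nu * INR l / INR n) * csc (PI * INR l / INR n))
          1 (n - 1).

Definition angle (n nu : nat) : R := 2 * PI * INR nu / INR n.

Definition poisson_integrand (n nu : nat) (x : R) : R :=
  ((1 + x ^ n) * cos (angle n nu) - x ^ (n - 1) - x) / (1 + x ^ n)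
  * (1 / (x ^ 2 - 2 * x * cos (angle n nu) + 1)).

Definition cosh_integrand (n nu : nat) (x : R) : R :=
  cosh (x * (INR n / 2 - 1))
  / (cosh (x * INR n / 2) * (cosh x - cos (angle n nu))).

(* Main.v *)
Require Import Defs.
From Stdlib Require Import Lra Lia.

(* Put M_j = int_0^1 x^j / (1 + x^n) dx.  If n phi is an odd multiple of PI, the
   finite sum of x^j sin((j+1) phi) over 0 <= j <= n-2 equals
   (1 + x^n) sin phi / (x^2 - 2 x cos phi + 1); integrating the kernel gives
   sum_j M_j sin((j+1) phi) = (PI - phi) / 2.  Discrete sine orthogonality over
   the n such angles phi_k = (2k+1) PI / n inverts this system and yields
   M_{l-1} + M_{n-l-1} = PI / (n sin(PI l / n)), so each cosecant is an integral.
   Summing the geometric cosine series at theta = 2 PI nu / n, for which n theta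
   is a multiple of 2 PI, gives the Poisson form; the substitution x = exp(-t)
   turns its non-constant part into the hyperbolic integral. *)

(** * Rearrangement of finite sums *)

Lemma sum_f_R0_ext (u v : nat -> R) (n : nat) :
  (forall k, u k = v k) -> sum_f_R0 u n = sum_f_R0 v n.
Proof. intros H. apply sum_eq. intros k _. apply H. Qed.

Lemma sum_f_R0_scal_l (a : R) (u : nat -> R) (n : nat) :
  sum_f_R0 (fun k => a * u k) n = a * sum_f_R0 u n.
Proof.
  rewrite scal_sum. apply sum_f_R0_ext. intros k. apply Rmult_comm.
Qed.

Lemma sum_f_R0_exchange (u : nat -> nat -> R) (m n : nat) :
  sum_f_R0 (fun i => sum_f_R0 (u i) n) m
  = sum_f_R0 (fun j => sum_f_R0 (fun i => u i j) m) n.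
Proof.
  induction m as [|m IH]; simpl; [reflexivity|].
  rewrite IH, <- plus_sum. reflexivity.
Qed.

Lemma sum_f_R0_rev (n : nat) (u : nat -> R) :
  sum_f_R0 (fun k => u (n - k)%nat) n = sum_f_R0 u n.
Proof.
  revert u; induction n as [|n IH]; intros u; [reflexivity|].
  rewrite tech5, Nat.sub_diag.
  rewrite (sum_eq _ (fun k => u (S (n - k))) n)
    by (intros k Hk; f_equal; lia).
  rewrite (IH (fun k => u (S k))), (decomp_sum u (S n)) by lia.
  apply Rplus_comm.
Qed.

Lemma sum_f_R0_delta (u : nat -> R) (i n : nat) : (i <= n)%nat ->
  sum_f_R0 (fun j => u j * (if Nat.eqb i j then 1 else 0)) n = u i.
Proof.
  assert (Hsmall : forall m, (m < i)%nat ->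
    sum_f_R0 (fun j => u j * (if Nat.eqb i j then 1 else 0)) m = 0).
  { induction m as [|m IH]; intros Hm; simpl sum_f_R0.
    - destruct (Nat.eqb_spec i 0); [lia|ring].
    - rewrite IH by lia.
      destruct (Nat.eqb_spec i (S m)); [lia|ring]. }
  induction n as [|n IH]; intros Hi; simpl sum_f_R0.
  - destruct (Nat.eqb_spec i 0); [subst; ring|lia].
  - destruct (Nat.eqb_spec i (S n)) as [e|e].
    + rewrite Hsmall by lia. subst; ring.
    + rewrite IH by lia. ring.
Qed.

Lemma is_RInt_sum_f_R0 (f : nat -> R -> R) (I : nat -> R) (a b : R) (n : nat) :
  (forall k, is_RInt (f k) a b (I k)) ->
  is_RInt (fun x => sum_f_R0 (fun k => f k x) n) a b (sum_f_R0 I n).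
Proof.
  intros H. induction n as [|n IH]; [apply H|].
  apply (is_RInt_plus (V := R_NormedModule)); [apply IH|apply H].
Qed.

(** * Trigonometric values and positivity of the denominators *)

Lemma sin_double_mult (k : nat) : sin (2 * PI * INR k) = 0.
Proof.
  replace (2 * PI * INR k) with (0 + 2 * INR k * PI) by ring.
  rewrite sin_period; apply sin_0.
Qed.

Lemma cos_double_mult (k : nat) : cos (2 * PI * INR k) = 1.
Proof.
  replace (2 * PI * INR k) with (0 + 2 * INR k * PI) by ring.
  rewrite cos_period; apply cos_0.
Qed.

Lemma cos_lt_1 (phi : R) : 0 < phi < 2 * PI -> cos phi < 1.
Proof.
  intros H. replace phi with (2 * (phi / 2)) by field.
  rewrite cos_2a_sin.
  assert (0 < sin (phi / 2)) by (apply sin_gt_0; lra). nra.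
Qed.

(** The squared distance from x to the point of argument phi on the unit circle, that is, the
    denominator of the Poisson kernel. *)
Definition kernel_denom (phi x : R) : R := x ^ 2 - 2 * x * cos phi + 1.

(** The denominator is [(1 - x)^2 + 2 x (1 - cos phi)] and also [(1 + x)^2 - 2 x (1 + cos phi)]; the
    sign of x decides which form is useful. The range reaches below 0 because a primitive is later
    differentiated at 0 itself. *)
Lemma kernel_denom_pos (phi x : R) :
  cos phi < 1 -> -1 < x -> 0 < kernel_denom phi x.
Proof.
  intros Hc Hx. unfold kernel_denom. pose proof (COS_bound phi).
  destruct (Rlt_le_dec 0 x) as [H0|H0].
  - assert (0 < x * (1 - cos phi)) by (apply Rmult_lt_0_compat; lra).
    pose proof (pow2_ge_0 (1 - x)). nra.
  - assert (0 <= - x * (1 + cos phi)) by (apply Rmult_le_pos; lra).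
    assert (0 < (1 + x) ^ 2) by (apply pow_lt; lra). nra.
Qed.

Lemma pow_add_1_pos (n : nat) (x : R) : -1 < x -> 0 < 1 + x ^ n.
Proof.
  intros Hx. destruct (Rle_lt_dec 0 x) as [H|H].
  - pose proof (pow_le x n H). lra.
  - destruct n as [|n]; [simpl; lra|].
    assert (Rabs (x ^ S n) < 1).
    { rewrite <- RPow_abs. rewrite Rabs_left by lra.
      apply pow_lt_1_compat; [lra|lia]. }
    apply Rabs_def2 in H0. lra.
Qed.

(** * Geometric sums of sines and cosines *)

Lemma sum_geom_cos (a phi x : R) (n : nat) :
  sum_f_R0 (fun j => x ^ j * cos (a + INR j * phi)) n * kernel_denom phi x
  = cos a - x * cos (a - phi) - x ^ (n + 1) * cos (a + INR (n + 1) * phi)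
    + x ^ (n + 2) * cos (a + INR n * phi).
Proof.
  (* The coefficients of [kernel_denom] are those of this recurrence, so in the product all powers
     of x cancel except the two lowest and the two highest. *)
  assert (Hrec : forall t, cos (t + phi) = 2 * cos t * cos phi - cos (t - phi)).
  { intros t. rewrite cos_plus, cos_minus. ring. }
  unfold kernel_denom. induction n as [|n IH].
  - simpl sum_f_R0. simpl INR. rewrite !Rmult_0_l, !Rplus_0_r, !Rmult_1_l, Hrec.
    simpl; ring.
  - rewrite tech5, Rmult_plus_distr_r, IH.
    replace (a + INR (S n + 1) * phi) with (a + INR (S n) * phi + phi)
      by (rewrite !plus_INR, !S_INR; simpl; ring).
    rewrite Hrec.
    replace (a + INR (S n) * phi - phi) with (a + INR n * phi)
      by (rewrite !S_INR; ring).
    replace (INR (n + 1)) with (INR (S n)) by (f_equal; lia).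
    replace (n + 1)%nat with (S n) by lia.
    replace (n + 2)%nat with (S (S n)) by lia.
    replace (S n + 1)%nat with (S (S n)) by lia.
    replace (S n + 2)%nat with (S (S (S n))) by lia.
    simpl pow; ring.
Qed.

(** A sine is a cosine delayed by [PI / 2], so this is [sum_geom_cos] at [a = phi - PI / 2]. The
    hypothesis makes [(n + 2) phi] an odd multiple of [PI]: one boundary term at each end vanishes
    and the other two combine into the factor [1 + x^(n+2)]. *)
Lemma sum_geom_sin_antiperiodic (n : nat) (phi x : R) :
  cos (INR (n + 2) * phi) = -1 ->
  sum_f_R0 (fun j => x ^ j * sin (INR (j + 1) * phi)) n * kernel_denom phi x
  = (1 + x ^ (n + 2)) * sin phi.
Proof.
  intros Hc.
  assert (Hs : sin (INR (n + 2) * phi) = 0).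
  { apply Rsqr_0_uniq. rewrite sin2, Hc. unfold Rsqr; ring. }
  rewrite (sum_f_R0_ext _ (fun j => x ^ j * cos (phi - PI / 2 + INR j * phi))).
  2:{ intros j. rewrite <- (cos_shift (INR (j + 1) * phi)).
      rewrite <- (cos_neg (PI / 2 - _)). do 2 f_equal.
      rewrite plus_INR; simpl; ring. }
  rewrite sum_geom_cos.
  assert (Hcs : forall t, cos (t - PI / 2) = sin t).
  { intros t. rewrite <- cos_neg, <- cos_shift. f_equal; ring. }
  rewrite Hcs.
  replace (phi - PI / 2 - phi) with (0 - PI / 2) by ring.
  rewrite Hcs, sin_0.
  replace (phi - PI / 2 + INR (n + 1) * phi) with (INR (n + 2) * phi - PI / 2)
    by (rewrite !plus_INR; simpl; ring).
  rewrite Hcs, Hs.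
  replace (phi - PI / 2 + INR n * phi) with ((INR (n + 2) * phi - phi) - PI / 2)
    by (rewrite !plus_INR; simpl; ring).
  rewrite Hcs, sin_minus, Hs, Hc. ring.
Qed.

(** This is [sum_geom_cos] at [a = phi], with [(n + 2) phi] a multiple of [2 PI]. The right-hand
    side is the numerator of [poisson_integrand] at order [n + 2]. *)
Lemma sum_geom_cos_periodic (n : nat) (phi x : R) :
  cos (INR (n + 2) * phi) = 1 ->
  sum_f_R0 (fun j => x ^ j * cos (INR (j + 1) * phi)) n * kernel_denom phi x
  = (1 + x ^ (n + 2)) * cos phi - x ^ (n + 1) - x.
Proof.
  intros Hc.
  assert (Hs : sin (INR (n + 2) * phi) = 0).
  { apply Rsqr_0_uniq. rewrite sin2, Hc. unfold Rsqr; ring. }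
  rewrite (sum_f_R0_ext _ (fun j => x ^ j * cos (phi + INR j * phi))).
  2:{ intros j. do 2 f_equal. rewrite plus_INR; simpl; ring. }
  rewrite sum_geom_cos.
  replace (phi - phi) with 0 by ring.
  replace (phi + INR (n + 1) * phi) with (INR (n + 2) * phi)
    by (rewrite !plus_INR; simpl; ring).
  replace (phi + INR n * phi) with (INR (n + 2) * phi - phi)
    by (rewrite !plus_INR; simpl; ring).
  rewrite cos_minus, cos_0, Hs, Hc. ring.
Qed.

(** * Discrete Fourier sums over the odd angles *)

Lemma sum_cos_odd (b : R) (n : nat) :
  2 * sin b * sum_f_R0 (fun k => cos ((2 * INR k + 1) * b)) n
  = sin (2 * INR (n + 1) * b).
Proof.
  induction n as [|n IH].
  - simpl sum_f_R0. simpl INR.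
    replace ((2 * 0 + 1) * b) with b by ring.
    replace (2 * 1 * b) with (2 * b) by ring. rewrite sin_2a. ring.
  - rewrite tech5, Rmult_plus_distr_l, IH.
    replace (2 * INR (n + 1) * b) with ((2 * INR (S n) + 1) * b - b)
      by (rewrite plus_INR, !S_INR; simpl; ring).
    replace (2 * INR (S n + 1) * b) with ((2 * INR (S n) + 1) * b + b)
      by (rewrite plus_INR, !S_INR; simpl; ring).
    rewrite sin_minus, sin_plus. ring.
Qed.

Lemma sum_cos_even (b : R) (n : nat) :
  2 * sin b * sum_f_R0 (fun k => cos (2 * INR k * b)) n
  = sin ((2 * INR n + 1) * b) + sin b.
Proof.
  induction n as [|n IH].
  - simpl sum_f_R0. simpl INR.
    replace (2 * 0 * b) with 0 by ring. rewrite cos_0.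
    replace ((2 * 0 + 1) * b) with b by ring. ring.
  - rewrite tech5, Rmult_plus_distr_l, IH.
    replace ((2 * INR n + 1) * b) with (2 * INR (S n) * b - b)
      by (rewrite !S_INR; simpl; ring).
    replace ((2 * INR (S n) + 1) * b) with (2 * INR (S n) * b + b)
      by (rewrite !S_INR; simpl; ring).
    rewrite sin_minus, sin_plus. ring.
Qed.

Lemma sin_mult_PI_div_pos (m n : nat) : (0 < m < n)%nat ->
  0 < sin (PI * INR m / INR n).
Proof.
  intros [Hm Hn]. apply lt_INR in Hm. apply lt_INR in Hn. simpl in Hm.
  pose proof PI_RGT_0.
  apply sin_gt_0.
  - apply Rdiv_lt_0_compat; nra.
  - apply Rlt_div_l; nra.
Qed.

(** The arguments of the n-th roots of -1, the complex zeros of [1 + x^n]. *)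
Definition odd_angle (n k : nat) : R := PI * (2 * INR k + 1) / INR n.

Lemma odd_angle_bounds (n k : nat) : (k < n)%nat ->
  0 < odd_angle n k < 2 * PI.
Proof.
  intros H. pose proof PI_RGT_0. pose proof (pos_INR k).
  assert (INR k + 1 <= INR n) by (rewrite <- S_INR; apply le_INR; lia).
  unfold odd_angle. split.
  - apply Rdiv_lt_0_compat; nra.
  - apply Rlt_div_l; nra.
Qed.

Lemma cos_mult_odd_angle (n k : nat) : (0 < n)%nat ->
  cos (INR n * odd_angle n k) = -1.
Proof.
  intros H. apply lt_INR in H; simpl in H.
  replace (INR n * odd_angle n k) with (PI + 2 * INR k * PI)
    by (unfold odd_angle; field; lra).
  rewrite cos_period. apply cos_PI.
Qed.

Lemma sum_cos_odd_angle_eq0 (n m : nat) : (0 < m < n + 1)%nat ->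
  sum_f_R0 (fun k => cos (INR m * odd_angle (n + 1) k)) n = 0.
Proof.
  intros Hm. pose proof (sin_mult_PI_div_pos m (n + 1) Hm) as Hs.
  assert (0 < INR (n + 1)) by (apply lt_0_INR; lia).
  rewrite (sum_f_R0_ext _ (fun k => cos ((2 * INR k + 1) * (PI * INR m / INR (n + 1)))))
    by (intros k; f_equal; unfold odd_angle; field; lra).
  apply (Rmult_eq_reg_l (2 * sin (PI * INR m / INR (n + 1)))); [|lra].
  rewrite sum_cos_odd.
  replace (2 * INR (n + 1) * (PI * INR m / INR (n + 1))) with (2 * PI * INR m)
    by (field; lra).
  rewrite sin_double_mult. ring.
Qed.

(** The terms are all 1 at [m = 0] and all -1 at [m = n + 1]; elsewhere the sum vanishes.
    Frequencies above [n + 1] are covered because orthogonality meets the sum of two indices. *)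
Lemma sum_cos_odd_angle (n m : nat) : (m < 2 * (n + 1))%nat ->
  sum_f_R0 (fun k => cos (INR m * odd_angle (n + 1) k)) n
  = INR (n + 1) * ((if Nat.eqb m 0 then 1 else 0)
                   - (if Nat.eqb m (n + 1) then 1 else 0)).
Proof.
  intros Hm.
  assert (Hconst : forall a, sum_f_R0 (fun _ => a) n = INR (n + 1) * a).
  { intros a. rewrite sum_cte, Nat.add_1_r. ring. }
  destruct (Nat.eqb_spec m 0) as [->|H0].
  { rewrite (sum_f_R0_ext _ (fun _ => 1)).
    2:{ intros k. simpl INR. rewrite Rmult_0_l. apply cos_0. }
    rewrite Hconst. destruct (Nat.eqb_spec 0 (n + 1)); [lia|ring]. }
  destruct (Nat.eqb_spec m (n + 1)) as [->|H1].
  { rewrite (sum_f_R0_ext _ (fun _ => -1))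
      by (intros k; apply cos_mult_odd_angle; lia).
    rewrite Hconst. ring. }
  destruct (Nat.lt_ge_cases m (n + 1)) as [Hlt|Hge].
  { rewrite sum_cos_odd_angle_eq0 by lia. ring. }
  (* Since [2 (n + 1)] times an odd angle is a multiple of [2 PI], the frequency m can be folded to
     [2 (n + 1) - m], which lies below [n + 1]. *)
  rewrite (sum_f_R0_ext _ (fun k => cos (INR (2 * (n + 1) - m) * odd_angle (n + 1) k))).
  { rewrite sum_cos_odd_angle_eq0 by lia. ring. }
  intros k. rewrite minus_INR, mult_INR by lia. change (INR 2) with 2.
  rewrite Rmult_minus_distr_r.
  replace (2 * INR (n + 1) * odd_angle (n + 1) k)
    with (0 + 2 * INR (2 * k + 1) * PI).
  2:{ unfold odd_angle. rewrite (plus_INR (2 * k)), mult_INR. change (INR 2) with 2.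
      simpl (INR 1). field. apply not_0_INR; lia. }
  rewrite <- cos_neg, <- (cos_period (- _) (2 * k + 1)). f_equal. ring.
Qed.

(** By product-to-sum, the frequency [j - i] contributes when [i = j] and the frequency [i + j + 2]
    when it equals [n + 2]. The second delta reflects a symmetry: at these angles [sin((j+1) phi)]
    does not change under [j -> n - j], so inversion can only recover moments in symmetric pairs. *)
Lemma sum_sin_odd_angle_orthogonal (n i j : nat) : (i <= n)%nat -> (j <= n)%nat ->
  sum_f_R0 (fun k => sin (INR (i + 1) * odd_angle (n + 2) k)
                  * sin (INR (j + 1) * odd_angle (n + 2) k)) (n + 1)
  = INR (n + 2) / 2 * ((if Nat.eqb i j then 1 else 0)
                       + (if Nat.eqb (n - i) j then 1 else 0)).
Proof.
  (* Ordering the indices makes the natural subtraction [j - i] exact; the other order follows by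
     symmetry of the product. *)
  assert (Hw : forall i j, (i <= j)%nat -> (j <= n)%nat ->
    sum_f_R0 (fun k => sin (INR (i + 1) * odd_angle (n + 2) k)
                    * sin (INR (j + 1) * odd_angle (n + 2) k)) (n + 1)
    = INR (n + 2) / 2 * ((if Nat.eqb i j then 1 else 0)
                         + (if Nat.eqb (n - i) j then 1 else 0))).
  { clear i j. intros i j Hij Hj.
    rewrite (sum_f_R0_ext _ (fun k => / 2 * cos (INR (j - i) * odd_angle (n + 1 + 1) k)
      + - / 2 * cos (INR (i + j + 2) * odd_angle (n + 1 + 1) k))).
    2:{ intros k. replace (n + 1 + 1)%nat with (n + 2)%nat by lia.
        set (t := odd_angle (n + 2) k).
        replace (INR (j - i) * t) with (INR (j + 1) * t - INR (i + 1) * t)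
          by (rewrite minus_INR, !plus_INR by lia; simpl; ring).
        replace (INR (i + j + 2) * t) with (INR (j + 1) * t + INR (i + 1) * t)
          by (rewrite !plus_INR; simpl; ring).
        rewrite cos_minus, cos_plus. field. }
    rewrite plus_sum, !sum_f_R0_scal_l, !sum_cos_odd_angle by lia.
    replace (n + 1 + 1)%nat with (n + 2)%nat by lia.
    destruct (Nat.eqb_spec (j - i) 0); destruct (Nat.eqb_spec i j); try lia;
    destruct (Nat.eqb_spec (j - i) (n + 2)); try lia;
    destruct (Nat.eqb_spec (i + j + 2) 0); try lia;
    destruct (Nat.eqb_spec (i + j + 2) (n + 2));
    destruct (Nat.eqb_spec (n - i) j); try lia; field. }
  intros Hi Hj. destruct (Nat.le_ge_cases i j) as [H|H]; [now apply Hw|].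
  rewrite (sum_f_R0_ext _ _ _ (fun k => Rmult_comm _ _)), Hw by lia.
  destruct (Nat.eqb_spec i j); destruct (Nat.eqb_spec j i); try lia;
  destruct (Nat.eqb_spec (n - i) j); destruct (Nat.eqb_spec (n - j) i);
  try lia; reflexivity.
Qed.

(** Summation by parts: the weight drops by 2 at each step, hence the factor 2 on the sum of c. *)
Lemma sum_abel_linear (a : R) (c : nat -> R) (n : nat) :
  sum_f_R0 (fun k => (a - 2 * INR k) * (c k - c (S k))) n
  = (a + 2) * c O - 2 * sum_f_R0 c n - (a - 2 * INR n) * c (S n).
Proof.
  induction n as [|n IH].
  - simpl sum_f_R0. simpl; ring.
  - rewrite !tech5, IH, !S_INR. ring.
Qed.

(** The sawtooth is linear in k, with [PI - odd_angle (n + 1) k = PI (n - 2 k) / (n + 1)], and the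
    sine is the difference [c k - c (S k)] divided by [2 sin b]. Summation by parts then leaves only
    boundary terms, because c sums to 0 over a full period. *)
Lemma sum_sin_odd_angle_sawtooth (n m : nat) : (0 < m < n + 1)%nat ->
  sum_f_R0 (fun k => (PI - odd_angle (n + 1) k) / 2
                  * sin (INR m * odd_angle (n + 1) k)) n
  = PI / (2 * sin (PI * INR m / INR (n + 1))).
Proof.
  intros Hm. pose proof (sin_mult_PI_div_pos m (n + 1) Hm) as Hs.
  assert (Hn : 0 < INR (n + 1)) by (apply lt_0_INR; lia).
  set (b := PI * INR m / INR (n + 1)) in *.
  set (c := fun k => cos (2 * INR k * b)).
  assert (Hb : INR (n + 1) * b = PI * INR m) by (unfold b; field; lra).
  rewrite (sum_f_R0_ext _ (fun k => (PI / (4 * INR (n + 1) * sin b))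
      * ((INR n - 2 * INR k) * (c k - c (S k))))).
  2:{ intros k. unfold c.
      replace (INR m * odd_angle (n + 1) k) with ((2 * INR k + 1) * b)
        by (unfold odd_angle, b; field; lra).
      replace (2 * INR k * b) with ((2 * INR k + 1) * b - b) by ring.
      replace (2 * INR (S k) * b) with ((2 * INR k + 1) * b + b)
        by (rewrite S_INR; ring).
      rewrite cos_minus, cos_plus.
      replace (PI - odd_angle (n + 1) k)
        with (PI * (INR n - 2 * INR k) / INR (n + 1)).
      - field. lra.
      - unfold odd_angle. rewrite plus_INR in *. simpl in *. field. lra. }
  rewrite sum_f_R0_scal_l, sum_abel_linear.
  assert (Hz : sum_f_R0 c n = 0).
  { apply (Rmult_eq_reg_l (2 * sin b)); [|lra].
    unfold c; rewrite sum_cos_even.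
    replace ((2 * INR n + 1) * b) with (2 * PI * INR m - b)
      by (rewrite plus_INR in Hb; simpl in Hb; lra).
    rewrite sin_minus, sin_double_mult, cos_double_mult. ring. }
  rewrite Hz. unfold c. simpl (INR 0). rewrite Rmult_0_r, Rmult_0_l, cos_0.
  replace (2 * INR (S n) * b) with (2 * PI * INR m)
    by (rewrite Nat.add_1_r in Hb; lra).
  rewrite cos_double_mult. rewrite plus_INR in *; simpl in *. field; lra.
Qed.

(** * The integral of the kernel over the unit interval *)

Ltac module_to_R :=
  unfold minus, plus, opp, scal; simpl; unfold mult; simpl;
  match goal with |- @eq _ ?a ?b => change (@eq R a b) end.

(** A primitive is [atan ((x - cos phi) / sin phi)], whose argument is [tan (phi - PI / 2)] at 0 and
    [tan (phi / 2)] at 1. For phi below [PI] both angles lie in the principal range of [atan]. *)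
Lemma is_RInt_kernel_upper (phi : R) : 0 < phi < PI ->
  is_RInt (fun x => sin phi / kernel_denom phi x) 0 1 ((PI - phi) / 2).
Proof.
  intros H.
  assert (Hs : 0 < sin phi) by (apply sin_gt_0; lra).
  assert (Hc : cos phi < 1) by (apply cos_lt_1; lra).
  pose proof (sin2_cos2 phi) as Hsc. unfold Rsqr in Hsc.
  assert (H0 : atan ((0 - cos phi) / sin phi) = phi - PI / 2).
  { rewrite <- (atan_tan (phi - PI / 2)) by lra. f_equal. unfold tan.
    rewrite sin_minus, cos_minus, sin_PI2, cos_PI2. field. lra. }
  assert (H1 : atan ((1 - cos phi) / sin phi) = phi / 2).
  { rewrite <- (atan_tan (phi / 2)) by lra. f_equal. unfold tan.
    assert (0 < sin (phi / 2)) by (apply sin_gt_0; lra).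
    assert (0 < cos (phi / 2)) by (apply cos_gt_0; lra).
    replace (sin phi) with (sin (2 * (phi / 2))) by (f_equal; field).
    replace (cos phi) with (cos (2 * (phi / 2))) by (f_equal; field).
    rewrite cos_2a_sin, sin_2a. field. lra. }
  replace ((PI - phi) / 2) with
    (minus (atan ((1 - cos phi) / sin phi)) (atan ((0 - cos phi) / sin phi))).
  2:{ rewrite H0, H1. module_to_R. field. }
  apply (is_RInt_derive (fun x => atan ((x - cos phi) / sin phi))).
  - intros x _. auto_derive; [exact I|]. unfold Rsqr, kernel_denom.
    assert (0 < (x - cos phi) ^ 2 + sin phi * sin phi).
    { pose proof (pow2_ge_0 (x - cos phi)). nra. }
    replace (x ^ 2 - 2 * x * cos phi + 1)
      with ((x - cos phi) ^ 2 + sin phi * sin phi).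
    + field. split; [|lra]. intro E. nra.
    + ring_simplify. nra.
  - intros x Hx. rewrite Rmin_left, Rmax_right in Hx by lra.
    pose proof (kernel_denom_pos phi x Hc ltac:(lra)) as Hp.
    unfold kernel_denom in *.
    apply (ex_derive_continuous (V := R_NormedModule)). auto_derive. lra.
Qed.

Lemma is_RInt_kernel (phi : R) : 0 < phi < 2 * PI ->
  is_RInt (fun x => sin phi / kernel_denom phi x) 0 1 ((PI - phi) / 2).
Proof.
  intros H. destruct (Rtotal_order phi PI) as [Hlt|[->|Hgt]].
  - apply is_RInt_kernel_upper; lra.
  - replace ((PI - PI) / 2) with (scal (1 - 0) 0) by (module_to_R; field).
    apply (is_RInt_ext (fun _ => 0)).
    + intros x _. rewrite sin_PI. module_to_R. unfold Rdiv; ring.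
    + apply (is_RInt_const (V := R_NormedModule)).
  (* Reflecting phi to [2 PI - phi] keeps the denominator and changes the sign of both the sine and
     the value. *)
  - pose proof (is_RInt_kernel_upper (2 * PI - phi) ltac:(lra)) as K.
    apply (is_RInt_opp (V := R_NormedModule)) in K.
    replace ((PI - phi) / 2) with (opp ((PI - (2 * PI - phi)) / 2))
      by (module_to_R; field).
    revert K. apply is_RInt_ext. intros x _. module_to_R; unfold kernel_denom.
    rewrite cos_minus, sin_minus, cos_2PI, sin_2PI.
    replace (1 * cos phi + 0 * sin phi) with (cos phi) by ring.
    unfold Rdiv. ring.
Qed.

(** At [PI] the factor [sin phi] in [is_RInt_kernel] vanishes and hides the integral of the
    reciprocal denominator; this value serves the case [2 nu = n]. *)
Lemma is_RInt_kernel_PI : is_RInt (fun x => / kernel_denom PI x) 0 1 (/ 2).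
Proof.
  replace (/ 2) with (minus (- / (1 + 1)) (- / (0 + 1)))
    by (module_to_R; field).
  assert (E : forall x, kernel_denom PI x = (x + 1) * (x + 1)).
  { intros x. unfold kernel_denom. rewrite cos_PI. ring. }
  apply (is_RInt_ext (fun x => / ((x + 1) * (x + 1)))).
  { intros x _. now rewrite E. }
  apply (is_RInt_derive (fun x => - / (x + 1))); intros x Hx;
    rewrite Rmin_left, Rmax_right in Hx by lra.
  - auto_derive; [lra|]. field; lra.
  - apply (ex_derive_continuous (V := R_NormedModule)). auto_derive. nra.
Qed.

(** * Moments of the reciprocal of [1 + x^n] and the cosecant *)

Definition mellin (n j : nat) : R := RInt (fun x => x ^ j / (1 + x ^ n)) 0 1.

Lemma is_RInt_mellin (n j : nat) :
  is_RInt (fun x => x ^ j / (1 + x ^ n)) 0 1 (mellin n j).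
Proof.
  apply (RInt_correct (V := R_CompleteNormedModule)), ex_RInt_continuous.
  intros x Hx. rewrite Rmin_left, Rmax_right in Hx by lra.
  pose proof (pow_add_1_pos n x ltac:(lra)).
  apply (ex_derive_continuous (V := R_NormedModule)). auto_derive. lra.
Qed.

Lemma is_RInt_sum_mellin (n m : nat) (c : nat -> R) :
  is_RInt (fun x => sum_f_R0 (fun j => x ^ j * c j) m / (1 + x ^ n)) 0 1
    (sum_f_R0 (fun j => mellin n j * c j) m).
Proof.
  apply (is_RInt_ext
           (fun x => sum_f_R0 (fun j => c j * (x ^ j / (1 + x ^ n))) m)).
  { intros x _. unfold Rdiv at 2. rewrite Rmult_comm.
    rewrite <- sum_f_R0_scal_l. apply sum_f_R0_ext. intros j.
    unfold Rdiv. ring. }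
  rewrite (sum_f_R0_ext _ (fun j => c j * mellin n j))
    by (intros; apply Rmult_comm).
  apply is_RInt_sum_f_R0. intros j.
  exact (is_RInt_scal (V := R_NormedModule) _ _ _ (c j) _ (is_RInt_mellin n j)).
Qed.

Lemma sum_mellin_sin (n : nat) (phi : R) :
  0 < phi < 2 * PI -> cos (INR (n + 2) * phi) = -1 ->
  sum_f_R0 (fun j => mellin (n + 2) j * sin (INR (j + 1) * phi)) n
  = (PI - phi) / 2.
Proof.
  intros H Hc.
  rewrite <- (is_RInt_unique _ _ _ _ (is_RInt_kernel phi H)). symmetry.
  apply is_RInt_unique.
  apply (is_RInt_ext (fun x => sum_f_R0 (fun j => x ^ j * sin (INR (j + 1) * phi)) n
                               / (1 + x ^ (n + 2)))).
  - intros x Hx. rewrite Rmin_left, Rmax_right in Hx by lra.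
    pose proof (kernel_denom_pos phi x (cos_lt_1 phi H) ltac:(lra)).
    pose proof (pow_add_1_pos (n + 2) x ltac:(lra)).
    pose proof (sum_geom_sin_antiperiodic n phi x Hc) as E.
    apply (Rmult_eq_reg_r (kernel_denom phi x * (1 + x ^ (n + 2)))); [|nra].
    field_simplify; [|lra|lra]. rewrite E. ring.
  - apply is_RInt_sum_mellin.
Qed.

(** Under [x -> 1/x] the second moment becomes the part over x > 1 of the first, so this is Euler's
    integral of [x^i / (1 + x^(n+2))] over the half-line. It is proved here by pairing
    [sum_mellin_sin] at the odd angles with [sin((i+1) phi_k)]: orthogonality isolates the two
    moments and the sawtooth sum gives the value. *)
Lemma mellin_reflection (n i : nat) : (i <= n)%nat ->
  mellin (n + 2) i + mellin (n + 2) (n - i)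
  = PI / INR (n + 2) * / sin (PI * INR (i + 1) / INR (n + 2)).
Proof.
  intros Hi.
  assert (Hn : 0 < INR (n + 2)) by (apply lt_0_INR; lia).
  pose proof (sin_mult_PI_div_pos (i + 1) (n + 2) ltac:(lia)) as Hs.
  pose proof (sum_sin_odd_angle_sawtooth (n + 1) (i + 1) ltac:(lia)) as E.
  replace (n + 1 + 1)%nat with (n + 2)%nat in E by lia.
  rewrite (sum_eq _ (fun k => sum_f_R0 (fun j => mellin (n + 2) j
             * (sin (INR (i + 1) * odd_angle (n + 2) k)
                * sin (INR (j + 1) * odd_angle (n + 2) k))) n)) in E.
  2:{ intros k Hk.
      rewrite <- (sum_mellin_sin n (odd_angle (n + 2) k)).
      - rewrite Rmult_comm, <- sum_f_R0_scal_l. apply sum_f_R0_ext.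
        intros j. ring.
      - apply odd_angle_bounds; lia.
      - apply cos_mult_odd_angle; lia. }
  rewrite sum_f_R0_exchange in E.
  rewrite (sum_eq _ (fun j => INR (n + 2) / 2 *
     (mellin (n + 2) j * (if Nat.eqb i j then 1 else 0)
      + mellin (n + 2) j * (if Nat.eqb (n - i) j then 1 else 0)))) in E.
  2:{ intros j Hj. rewrite sum_f_R0_scal_l.
      rewrite sum_sin_odd_angle_orthogonal by lia. ring. }
  rewrite sum_f_R0_scal_l, plus_sum, !sum_f_R0_delta in E by lia.
  apply (Rmult_eq_reg_l (INR (n + 2) / 2)); [|lra].
  rewrite E. field. lra.
Qed.

(** * From the cosecant sum to the Poisson integral *)

Lemma cos_csc_sum_mellin (n nu : nat) :
  cos_csc_sum (n + 2) nu
  = 2 * INR (n + 2) / PI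
    * sum_f_R0 (fun j => mellin (n + 2) j * cos (INR (j + 1) * angle (n + 2) nu)) n.
Proof.
  assert (Hn : 0 < INR (n + 2)) by (apply lt_0_INR; lia).
  pose proof PI_RGT_0 as HPI.
  unfold cos_csc_sum.
  replace (n + 2 - 1)%nat with (S n) by lia.
  rewrite <- (sum_n_m_S _ 0 n).
  change (sum_n_m ?u 0 n) with (sum_n u n). rewrite sum_n_Reals.
  set (c := fun j => cos (INR (j + 1) * angle (n + 2) nu)).
  (* With [l = j + 1], each cosecant splits into the moments of j and [n - j]. Reversing the second
     sum turns it into the first, which gives the factor 2. *)
  rewrite (sum_eq _ (fun j => INR (n + 2) / PI
     * (mellin (n + 2) j * c j + mellin (n + 2) (n - j) * c (n - j)%nat))).
  { rewrite sum_f_R0_scal_l, plus_sum.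
    rewrite (sum_f_R0_rev n (fun j => mellin (n + 2) j * c j)). unfold c. field. lra. }
  intros j Hj.
  (* The index [n - j] corresponds to [(n + 2) - l], and [n + 2] times the angle is a multiple of
     [2 PI]. *)
  assert (Hc : c (n - j)%nat = c j).
  { unfold c, angle.
    replace (INR (n - j + 1)) with (INR (n + 2) - INR (j + 1))
      by (rewrite <- minus_INR by lia; f_equal; lia).
    replace ((INR (n + 2) - INR (j + 1)) * (2 * PI * INR nu / INR (n + 2)))
      with (2 * PI * INR nu - INR (j + 1) * (2 * PI * INR nu / INR (n + 2)))
      by (field; lra).
    rewrite cos_minus, cos_double_mult, sin_double_mult. ring. }
  rewrite Hc, <- Rmult_plus_distr_r, mellin_reflection by lia.
  unfold csc, c, angle. rewrite <- Nat.add_1_r.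
  replace (2 * PI * INR nu * INR (j + 1) / INR (n + 2))
    with (INR (j + 1) * (2 * PI * INR nu / INR (n + 2))) by (field; lra).
  field. split; [|split]; try lra.
  apply Rgt_not_eq, sin_mult_PI_div_pos; lia.
Qed.

Lemma angle_bounds (n nu : nat) : (1 <= nu <= n - 1)%nat ->
  0 < angle n nu < 2 * PI.
Proof.
  intros H. pose proof PI_RGT_0.
  assert (1 <= INR nu) by (apply (le_INR 1); lia).
  assert (INR nu < INR n) by (apply lt_INR; lia).
  unfold angle. split.
  - apply Rdiv_lt_0_compat; nra.
  - apply Rlt_div_l; nra.
Qed.

Lemma is_RInt_poisson (n nu : nat) : (1 <= nu <= n + 1)%nat ->
  is_RInt (poisson_integrand (n + 2) nu) 0 1
    (PI / (2 * INR (n + 2)) * cos_csc_sum (n + 2) nu).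
Proof.
  intros Hnu.
  assert (Hn : 0 < INR (n + 2)) by (apply lt_0_INR; lia).
  pose proof PI_RGT_0 as HPI.
  assert (Ht : 0 < angle (n + 2) nu < 2 * PI) by (apply angle_bounds; lia).
  rewrite cos_csc_sum_mellin, <- Rmult_assoc.
  replace (PI / (2 * INR (n + 2)) * (2 * INR (n + 2) / PI)) with 1
    by (field; lra).
  rewrite Rmult_1_l.
  refine (is_RInt_ext _ _ _ _ _ _ (is_RInt_sum_mellin (n + 2) n _)).
  intros x Hx. rewrite Rmin_left, Rmax_right in Hx by lra.
  pose proof (kernel_denom_pos _ x (cos_lt_1 _ Ht) ltac:(lra)) as HD.
  pose proof (pow_add_1_pos (n + 2) x ltac:(lra)).
  pose proof (sum_geom_cos_periodic n (angle (n + 2) nu) x) as E.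
  unfold poisson_integrand. fold (kernel_denom (angle (n + 2) nu) x).
  replace (n + 2 - 1)%nat with (n + 1)%nat by lia. rewrite <- E.
  - module_to_R. field. lra.
  - unfold angle.
    replace (INR (n + 2) * (2 * PI * INR nu / INR (n + 2)))
      with (2 * PI * INR nu) by (field; lra).
    apply cos_double_mult.
Qed.

(** * The substitution [x = exp (- t)] and the hyperbolic integral *)

Lemma is_RInt_gen_comp_exp_opp (g : R -> R) :
  (forall x, -1 < x -> continuous g x) ->
  is_RInt_gen (fun t => exp (- t) * g (exp (- t)))
    (at_point 0) (Rbar_locally p_infty) (RInt g 0 1).
Proof.
  intros Hg.
  set (G := fun y => RInt g 0 y).
  (* Including y = 0 gives continuity of G there, which the limit at infinity requires. The radius
     [y + 1] keeps the neighbourhood to the right of -1. *)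
  assert (HG : forall y, -1 < y -> is_derive G y (g y)).
  { intros y Hy. apply is_derive_RInt with (a := 0).
    - exists (mkposreal (y + 1) ltac:(lra)). intros z Hz.
      apply (RInt_correct (V := R_CompleteNormedModule)), ex_RInt_continuous.
      intros w Hw. apply Hg.
      assert (-1 < z).
      { unfold ball in Hz; simpl in Hz. unfold AbsRing_ball, abs, minus, plus, opp in Hz.
        simpl in Hz. apply Rabs_def2 in Hz. lra. }
      assert (-1 < Rmin 0 z) by (apply Rmin_glb_lt; lra). lra.
    - now apply Hg. }
  assert (HF : forall t, is_derive (fun t => - G (exp (- t))) t
                           (exp (- t) * g (exp (- t)))).
  { intros t. pose proof (exp_pos (- t)) as Hp.
    pose proof (HG (exp (- t)) ltac:(lra)) as HGt.
    assert (He : is_derive (fun t => exp (- t)) t (- exp (- t)))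
      by (auto_derive; [exact I|ring]).
    replace (exp (- t) * g (exp (- t)))
      with (opp (scal (- exp (- t)) (g (exp (- t))))) by (module_to_R; ring).
    apply (is_derive_opp (V := R_NormedModule)), (is_derive_comp G); assumption. }
  (* The primitive [- G (exp (- t))] tends to 0 at infinity and equals [- G 1] at t = 0. *)
  replace (G 1) with (0 - - G 1) by (module_to_R; ring).
  apply (is_RInt_gen_ext (Derive (fun t => - G (exp (- t))))).
  { apply filter_forall. intros ab x _. apply is_derive_unique, HF. }
  refine (is_RInt_gen_Derive _ (- G 1) 0 _ _ _ _).
  - apply filter_forall. intros ab x _. eexists; apply HF.
  - apply filter_forall. intros ab x _.
    apply (continuous_ext (fun t => exp (- t) * g (exp (- t)))).
    { intros t. symmetry. apply is_derive_unique, HF. }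
    pose proof (exp_pos (- x)).
    assert (He : continuous (fun t => exp (- t)) x)
      by (apply (ex_derive_continuous (V := R_NormedModule)); auto_derive; exact I).
    apply (continuous_mult (fun t => exp (- t)) (fun t => g (exp (- t)))); [exact He|].
    apply (continuous_comp (fun t => exp (- t)) g); [exact He|].
    apply Hg. lra.
  - intros P HP. unfold filtermap, at_point.
    rewrite Ropp_0, exp_0. exact (locally_singleton _ _ HP).
  - replace 0 with (- G 0).
    2:{ unfold G. rewrite RInt_point. unfold zero; simpl. ring. }
    apply (filterlim_comp _ _ _ (fun t => exp (- t)) (fun y => - G y) _ (locally 0)).
    + change (is_lim (fun t => exp (- t)) p_infty 0).
      apply (is_lim_comp exp (fun t => - t) p_infty 0 m_infty).
      * apply is_lim_exp_m.
      * apply (is_lim_opp (fun t => t) p_infty p_infty), is_lim_id.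
      * exists 0. intros x _. discriminate.
    + apply (continuous_opp (V := R_NormedModule)).
      apply (ex_derive_continuous (V := R_NormedModule)).
      eexists. apply HG. lra.
Qed.

Lemma RInt_gen_unique_p_infty (f : R -> R) (a l : R) :
  is_RInt_gen f (at_point a) (Rbar_locally p_infty) l ->
  RInt_gen f (at_point a) (Rbar_locally p_infty) = l.
Proof.
  apply (is_RInt_gen_unique (V := R_CompleteNormedModule)).
Qed.

(** Factoring [y = exp (t (n + 2) / 2)] out of both hyperbolic cosines of multiples of t leaves
    polynomials in [exp (- t)], and y cancels in the quotient. *)
Lemma cosh_integrand_exp_opp (n nu : nat) (t : R) : cos (angle (n + 2) nu) < 1 ->
  cosh_integrand (n + 2) nu t
  = exp (- t) * (2 * (exp (- t) ^ (n + 1) + exp (- t)) / (1 + exp (- t) ^ (n + 2))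
                 / kernel_denom (angle (n + 2) nu) (exp (- t))).
Proof.
  intros Hc. pose proof (exp_pos (- t)) as Hx.
  pose proof (kernel_denom_pos _ (exp (- t)) Hc ltac:(lra)) as HD.
  pose proof (pow_add_1_pos (n + 2) (exp (- t)) ltac:(lra)) as Hp.
  assert (Hpow : forall k, exp (- t) ^ k = exp (- (INR k * t))).
  { intros k. induction k as [|k IH].
    - simpl. rewrite Rmult_0_l, Ropp_0, exp_0. reflexivity.
    - rewrite S_INR, <- tech_pow_Rmult, IH, <- exp_plus. f_equal. ring. }
  set (y := exp (t * INR (n + 2) / 2)).
  assert (Hy : 0 < y) by apply exp_pos.
  assert (E1 : cosh (t * (INR (n + 2) / 2 - 1))
               = y * (exp (- t) + exp (- t) ^ (n + 1)) / 2).
  { unfold cosh, y. rewrite Hpow, Rmult_plus_distr_l, <- !exp_plus.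
    do 3 f_equal; rewrite ?plus_INR; simpl; field. }
  assert (E2 : cosh (t * INR (n + 2) / 2) = y * (1 + exp (- t) ^ (n + 2)) / 2).
  { unfold cosh, y. rewrite Hpow, Rmult_plus_distr_l, Rmult_1_r, <- !exp_plus.
    do 3 f_equal; rewrite ?plus_INR; simpl; field. }
  assert (E3 : cosh t - cos (angle (n + 2) nu)
               = kernel_denom (angle (n + 2) nu) (exp (- t)) / (2 * exp (- t))).
  { unfold cosh, kernel_denom. rewrite (exp_Ropp t).
    pose proof (exp_pos t). field. lra. }
  unfold cosh_integrand. rewrite E1, E2, E3. field. lra.
Qed.

(** After substitution the integrand g is [2 cos th / kernel_denom th x] minus twice
    [poisson_integrand]. The integral I of the reciprocal denominator stays a parameter because its
    closed form differs when the angle is [PI]. *)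
Lemma is_RInt_gen_cosh (n nu : nat) (I : R) : (1 <= nu <= n + 1)%nat ->
  is_RInt (fun x => / kernel_denom (angle (n + 2) nu) x) 0 1 I ->
  is_RInt_gen (cosh_integrand (n + 2) nu) (at_point 0) (Rbar_locally p_infty)
    (2 * cos (angle (n + 2) nu) * I
     - PI / INR (n + 2) * cos_csc_sum (n + 2) nu).
Proof.
  intros Hnu HI.
  assert (Hn : 0 < INR (n + 2)) by (apply lt_0_INR; lia).
  assert (Ht : 0 < angle (n + 2) nu < 2 * PI) by (apply angle_bounds; lia).
  pose proof (cos_lt_1 _ Ht) as Hc.
  set (th := angle (n + 2) nu) in *.
  set (g := fun x => 2 * (x ^ (n + 1) + x) / (1 + x ^ (n + 2)) / kernel_denom th x).
  assert (Hg : RInt g 0 1 = 2 * cos th * I - PI / INR (n + 2) * cos_csc_sum (n + 2) nu).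
  { apply is_RInt_unique.
    replace (2 * cos th * I - PI / INR (n + 2) * cos_csc_sum (n + 2) nu)
      with (minus (scal (2 * cos th) I)
              (scal 2 (PI / (2 * INR (n + 2)) * cos_csc_sum (n + 2) nu))).
    2:{ module_to_R. field. lra. }
    refine (is_RInt_ext _ _ _ _ _ _
      (is_RInt_minus (V := R_NormedModule) _ _ _ _ _ _
         (is_RInt_scal (V := R_NormedModule) _ _ _ (2 * cos th) _ HI)
         (is_RInt_scal (V := R_NormedModule) _ _ _ 2 _ (is_RInt_poisson n nu Hnu)))).
    intros x Hx. rewrite Rmin_left, Rmax_right in Hx by lra.
    pose proof (kernel_denom_pos _ x Hc ltac:(lra)) as HD.
    pose proof (pow_add_1_pos (n + 2) x ltac:(lra)).
    module_to_R. unfold g, poisson_integrand.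
    fold th. fold (kernel_denom th x).
    replace (n + 2 - 1)%nat with (n + 1)%nat by lia. field. lra. }
  rewrite <- Hg.
  apply (is_RInt_gen_ext (fun t => exp (- t) * g (exp (- t)))).
  { apply filter_forall. intros ab t _. symmetry.
    now apply cosh_integrand_exp_opp. }
  apply is_RInt_gen_comp_exp_opp. intros x Hx.
  pose proof (kernel_denom_pos _ x Hc Hx) as HD.
  pose proof (pow_add_1_pos (n + 2) x Hx).
  unfold g, kernel_denom in *.
  apply (ex_derive_continuous (V := R_NormedModule)). auto_derive. lra.
Qed.

(** * The cotangent term and its removable singularity *)

Lemma is_lim_mult_cot (a : R) : 0 < a ->
  is_lim (fun t => (a - 2 * t) * cot (2 * PI * t / a)) (a / 2) (- a / PI).
Proof.
  intros Ha. pose proof PI_RGT_0 as HPI.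
  assert (Hsinc : is_lim (fun t => sin (2 * PI / a * (t - a / 2))
                                   / (2 * PI / a * (t - a / 2))) (a / 2) 1).
  { apply (is_lim_comp (fun x => sin x / x) (fun t => 2 * PI / a * (t - a / 2))
             (a / 2) 1 0 is_lim_sinc_0).
    - replace (Finite 0) with (Finite (2 * PI / a * (a / 2 - a / 2)))
        by (f_equal; ring).
      apply (is_lim_continuity (fun t => 2 * PI / a * (t - a / 2))).
      apply continuity_pt_filterlim.
      apply (ex_derive_continuous (V := R_NormedModule) (fun t => 2 * PI / a * (t - a / 2))).
      auto_derive; exact I.
    - exists (mkposreal 1 Rlt_0_1). intros t _ Hne E. apply Hne.
      injection E as E. apply Rmult_integral in E. destruct E as [E|E]; [|lra].
      assert (0 < 2 * PI / a) by (apply Rdiv_lt_0_compat; lra). lra. }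
  (* With [s = t - a / 2] the cotangent has argument [PI + 2 PI s / a] and the weight is [- 2 s], so
     the product is a cosine over a sinc, times [- a / PI]. Within distance [a / 2] the sine
     vanishes only at s = 0. *)
  apply (is_lim_ext_loc (fun t => - a / PI * cos (2 * PI / a * (t - a / 2))
     * / (sin (2 * PI / a * (t - a / 2)) / (2 * PI / a * (t - a / 2))))).
  { exists (mkposreal (a / 2) ltac:(lra)). intros t Hb Hne.
    assert (Hba : - (a / 2) < t - a / 2 < a / 2).
    { unfold ball in Hb; simpl in Hb.
      unfold AbsRing_ball, abs, minus, plus, opp in Hb.
      simpl in Hb. apply Rabs_def2 in Hb. lra. }
    set (s := t - a / 2) in *.
    assert (Hs0 : s <> 0) by (intro E; apply Hne; unfold s in E; lra).
    assert (Hk : 0 < 2 * PI / a) by (apply Rdiv_lt_0_compat; lra).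
    assert (Hb1 : 2 * PI / a * (a / 2) = PI) by (field; lra).
    assert (Hsin : sin (2 * PI / a * s) <> 0).
    { destruct (Rlt_le_dec 0 s).
      - apply Rgt_not_eq, sin_gt_0; nra.
      - assert (0 < sin (- (2 * PI / a * s))) by (apply sin_gt_0; nra).
        rewrite sin_neg in *. lra. }
    replace (2 * PI * t / a) with (2 * PI / a * s + PI)
      by (unfold s; field; lra).
    unfold cot. rewrite neg_cos, neg_sin.
    replace (a - 2 * t) with (- 2 * s) by (unfold s; field).
    field. repeat split; lra. }
  replace (Finite (- a / PI)) with (Rbar_mult (Finite (- a / PI * 1)) (Rbar_inv 1)).
  2:{ simpl. f_equal. field. lra. }
  apply is_lim_mult.
  - replace (- a / PI * 1) with (- a / PI * cos (2 * PI / a * (a / 2 - a / 2)))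
      by (rewrite Rminus_diag, Rmult_0_r, cos_0; reflexivity).
    apply (is_lim_continuity (fun t => - a / PI * cos (2 * PI / a * (t - a / 2)))).
    apply continuity_pt_filterlim.
    apply (ex_derive_continuous (V := R_NormedModule)
             (fun t => - a / PI * cos (2 * PI / a * (t - a / 2)))).
    auto_derive; exact I.
  - apply is_lim_inv; [exact Hsinc|]. intro E; injection E; lra.
  - simpl. exact I.
Qed.

Lemma sin_angle_neq0 (n nu : nat) : (1 <= nu <= n - 1)%nat -> (2 * nu)%nat <> n ->
  sin (angle n nu) <> 0.
Proof.
  intros H Hne. pose proof PI_RGT_0. pose proof (angle_bounds n nu H) as Hb.
  assert (Hn : 0 < INR n) by (apply lt_0_INR; lia).
  destruct (Rtotal_order (angle n nu) PI) as [Hlt|[He|Hgt]].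
  - apply Rgt_not_eq, sin_gt_0; lra.
  - exfalso. apply Hne, INR_eq. rewrite mult_INR. change (INR 2) with 2.
    unfold angle in He. apply (Rmult_eq_reg_l PI); [|lra].
    replace (PI * (2 * INR nu)) with (2 * PI * INR nu / INR n * INR n)
      by (field; lra).
    rewrite He. ring.
  - apply Rlt_not_eq, sin_lt_0; lra.
Qed.

(* When 2 nu = n the angle is PI, so (n - 2 nu) cot (2 PI nu / n) has the
   form 0 * infinity: it is read as the value of its continuous extension in
   nu.  For every other nu it is read literally. *)
Theorem theorem1 :
  forall n nu : nat, (2 <= n)%nat -> (1 <= nu <= n - 1)%nat ->
    (ex_RInt (poisson_integrand n nu) 0 1 /\
     cos_csc_sum n nu
     = 2 * INR n / PI * RInt (poisson_integrand n nu) 0 1)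
    /\
    (ex_RInt_gen (cosh_integrand n nu) (at_point 0) (Rbar_locally p_infty) /\
     ((2 * nu)%nat <> n ->
      cos_csc_sum n nu
      = (INR n - 2 * INR nu) * cot (2 * PI * INR nu / INR n)
        - INR n / PI
          * RInt_gen (cosh_integrand n nu) (at_point 0) (Rbar_locally p_infty))
     /\
     ((2 * nu)%nat = n ->
      exists c : R,
        is_lim (fun t : R => (INR n - 2 * t) * cot (2 * PI * t / INR n))
               (INR nu) c /\
        cos_csc_sum n nu
        = c
          - INR n / PI
            * RInt_gen (cosh_integrand n nu)
                       (at_point 0) (Rbar_locally p_infty))).
Proof.
  intros n' nu Hn2 Hnu.
  assert (Hn : 0 < INR n') by (apply lt_0_INR; lia).
  pose proof PI_RGT_0 as HPI.
  (* Writing the order as [n + 2] lets the moments be indexed from 0 to n. *)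
  destruct (Nat.le_exists_sub 2 n' Hn2) as [n [-> _]].
  pose proof (is_RInt_poisson n nu ltac:(lia)) as HP.
  assert (Hgen : (2 * nu)%nat <> (n + 2)%nat ->
    is_RInt (fun x => / kernel_denom (angle (n + 2) nu) x) 0 1
      ((PI - angle (n + 2) nu) / (2 * sin (angle (n + 2) nu)))).
  { intros Hne. pose proof (sin_angle_neq0 (n + 2) nu Hnu Hne) as Hs.
    pose proof (is_RInt_kernel _ (angle_bounds (n + 2) nu Hnu)) as K.
    apply (is_RInt_scal (V := R_NormedModule) _ _ _ (/ sin (angle (n + 2) nu))) in K.
    replace ((PI - angle (n + 2) nu) / (2 * sin (angle (n + 2) nu)))
      with (scal (/ sin (angle (n + 2) nu)) ((PI - angle (n + 2) nu) / 2))
      by (module_to_R; field; exact Hs).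
    revert K. apply is_RInt_ext. intros x _.
    module_to_R. unfold Rdiv.
    rewrite <- Rmult_assoc, Rinv_l by exact Hs. ring. }
  assert (Hmid : (2 * nu)%nat = (n + 2)%nat -> angle (n + 2) nu = PI).
  { intros He. unfold angle. rewrite <- He, mult_INR. change (INR 2) with 2.
    rewrite <- He, mult_INR in Hn. change (INR 2) with 2 in Hn. field. lra. }
  split; [split|split; [|split]].
  - eexists; exact HP.
  - rewrite (is_RInt_unique _ _ _ _ HP). field. lra.
  - destruct (Nat.eq_dec (2 * nu) (n + 2)) as [He|Hne].
    + eexists. apply (is_RInt_gen_cosh n nu (/ 2)); [lia|].
      rewrite (Hmid He). apply is_RInt_kernel_PI.
    + eexists. apply (is_RInt_gen_cosh n nu _ ltac:(lia) (Hgen Hne)).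
  - intros Hne.
    pose proof (is_RInt_gen_cosh n nu _ ltac:(lia) (Hgen Hne)) as HK.
    apply RInt_gen_unique_p_infty in HK. rewrite HK.
    pose proof (sin_angle_neq0 (n + 2) nu Hnu Hne) as Hs.
    unfold cot. fold (angle (n + 2) nu).
    (* In this form the cotangent term is [(n + 2) / PI] times [2 cos th] times the kernel integral
       [(PI - th) / (2 sin th)], with [th] the angle, and cancels against it. *)
    replace (INR (n + 2) - 2 * INR nu)
      with (INR (n + 2) / PI * (PI - angle (n + 2) nu))
      by (unfold angle; field; lra).
    field. lra.
  (* The witness is both the limit at the midpoint and the value forced by the integral, where
     [2 cos PI] times [/ 2] is -1. *)
  - intros He. exists (- INR (n + 2) / PI). split.
    + replace (INR nu) with (INR (n + 2) / 2).
      * now apply is_lim_mult_cot.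
      * rewrite <- He, mult_INR. change (INR 2) with 2. field.
    + assert (HI : is_RInt (fun x => / kernel_denom (angle (n + 2) nu) x) 0 1 (/ 2)).
      { rewrite (Hmid He). apply is_RInt_kernel_PI. }
      pose proof (is_RInt_gen_cosh n nu _ ltac:(lia) HI) as HK.
      apply RInt_gen_unique_p_infty in HK. rewrite HK.
      rewrite (Hmid He), cos_PI. field. lra.
Qed.
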